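(* For every nonnegative integer $n$, $$p\!\left(\frac n2\right)=\sum_{j=0}^{\infty}pod(j)\,q_{e-o}(n-j),$$ where $p(x)=0$ if $x$ is not an integer.
   Context: $p(n)$ denotes the number of (unrestricted) partitions of $n$, with $p(0)=1$. $pod(n)$ denotes the number of partitions of $n$ in which odd parts are distinct and even parts may be repeated, with $pod(0)=1$. $q_{e-o}(n)$ denotes the number of partitions of $n$ into distinct parts with an even number of odd parts minus the number of partitions of $n$ into distinct parts with an odd number of odd parts; $q_{e-o}(0)=1$ and $q_{e-o}(m)=0$ for $m<0$. Its generating function is $\sum_{n\ge0}q_{e-o}(n)q^n=\prod_{k\ge0}\frac{1}{1+q^{2k+1}}$. *)

(* Defs.v *)
From mathcomp Require Import all_boot all_order all_algebra.

Set Implicit Arguments.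
Unset Strict Implicit.
Unset Printing Implicit Defensive.

Import GRing.Theory Num.Theory.

Definition is_partition (n : nat) (s : seq nat) : bool :=
  [&& sorted geq s, 0 \notin s & sumn s == n].

(* Number of partitions of n satisfying P. A partition of n has at most n
   parts, each at most n, so it suffices to range over the finite type
   n.-bseq 'I_n.+1 (see is_partition_bseq). *)
Definition nb_partitions (P : pred (seq nat)) (n : nat) : nat :=
  #|[pred s : n.-bseq 'I_n.+1 |
      is_partition n (map val s) && P (map val s)]|.

Lemma is_partition_bseq (n : nat) (s : seq nat) :
  is_partition n s -> exists t : n.-bseq 'I_n.+1, map val t = s.
Proof.
case/and3P=> _ s_pos /eqP sum_s.
have size_s : size (map (@inord n) s) <= n.
  rewrite size_map -[leqRHS]sum_s.
  elim: s s_pos {sum_s} => //= x s IHs.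
  rewrite inE negb_or eq_sym -lt0n => /andP[x_gt0 /IHs le_s].
  by rewrite -add1n leq_add.
exists (Bseq size_s); rewrite /= -map_comp map_id_in // => x xs.
rewrite /= inordK // ltnS -sum_s.
elim: s xs {s_pos sum_s size_s} => //= y s IHs.
rewrite inE => /predU1P[-> | /IHs le_x]; first exact: leq_addr.
exact: leq_trans le_x (leq_addl _ _).
Qed.

Definition odd_parts (s : seq nat) : seq nat := [seq x <- s | odd x].

Definition p (x : rat) : nat :=
  if x \is a Num.nat then nb_partitions xpredT (Num.truncn x) else 0.

Definition pod (n : nat) : nat :=
  nb_partitions (fun s => uniq (odd_parts s)) n.

(* Being 0 on negative integers, q_eo (n - j) has finite support as a function
   of j : nat. *)
Definition q_eo (m : int) : int :=
  match m with
  | Posz n =>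
      ((nb_partitions (fun s => uniq s && ~~ odd (size (odd_parts s))) n)%:Z
       - (nb_partitions (fun s => uniq s && odd (size (odd_parts s))) n)%:Z)%R
  | Negz _ => 0%R
  end.

(* Main.v *)
(** Write the generating functions as
    pod = (-q;q^2)/(q^2;q^2) and q_eo = (q;q^2)(-q^2;q^2). Since
    (q;q^2)(-q;q^2) = (q^2;q^4), and (q^2;q^4)(-q^2;q^2) = 1 is Euler's
    odd/distinct identity in q^2, their product is 1/(q^2;q^2), the generating
    function of p(n/2). All identities are between finite products of
    polynomials, modulo q^(n+1); the i-th factor runs over the multiplicity of
    the part i+1. *)
Require Import Defs.
From mathcomp Require Import all_boot all_order all_algebra.
From mathcomp Require Import classical_sets fsbigop.

Import GRing.Theory Num.Theory.
Local Open Scope ring_scope.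

(** * Counting partitions as summation over a list *)

Definition partitions (n : nat) : seq (seq nat) :=
  [seq map val (t : n.-bseq 'I_n.+1)
  | t : n.-bseq 'I_n.+1 in [pred t : n.-bseq 'I_n.+1 | is_partition n (map val t)]].

Lemma mem_partitions n s : (s \in partitions n) = is_partition n s.
Proof.
apply/fintype.imageP/idP=> [[t +] -> //|s_part].
have [t def_s] := is_partition_bseq s_part.
by exists t; rewrite ?inE ?def_s.
Qed.

Lemma partitions_uniq n : uniq (partitions n).
Proof.
rewrite map_inj_in_uniq ?enum_uniq // => t u _ _ /(inj_map val_inj).
exact: val_inj.
Qed.

(** Turns a count into a weighted sum, so that signs and indicator weights can be compared with
    polynomial coefficients. *)
Lemma nb_partitionsE (R : pzSemiRingType) (P : pred (seq nat)) n :
  (nb_partitions P n)%:R = \sum_(s <- partitions n) (P s)%:R :> R.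
Proof.
rewrite big_image /= /nb_partitions -sum1_card natr_sum big_mkcondr /=.
by apply: eq_bigr => t _; case: (P _).
Qed.

(** * Partitions encoded by their multiplicities *)

Definition of_mults {L K : nat} (g : {ffun 'I_L -> 'I_K.+1}) : seq nat :=
  sort geq (flatten [seq nseq (g i) i.+1 | i : 'I_L]).

Section Multiplicities.
Variables (L K : nat).
Implicit Type g : {ffun 'I_L -> 'I_K.+1}.

Lemma count_of_mults g (i : 'I_L) : count_mem i.+1 (of_mults g) = g i.
Proof.
rewrite count_sort count_flatten sumnE big_map big_image /=.
rewrite (bigD1 i) //= count_nseq /= eqxx mul1n big1 ?addn0 // => j ne_ji.
by rewrite count_nseq /= eqSS val_eqE (negPf ne_ji).
Qed.

Lemma of_mults_inj : injective (@of_mults L K).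
Proof.
by move=> g h eq_gh; apply/ffunP=> i; apply/val_inj; rewrite /= -!count_of_mults eq_gh.
Qed.

Lemma mem_of_mults g x : x \in of_mults g -> exists i : 'I_L, x = i.+1.
Proof.
rewrite mem_sort => /flatten_mapP[i _]; rewrite mem_nseq => /andP[_ /eqP ->].
by exists i.
Qed.

Lemma sumn_of_mults g : sumn (of_mults g) = (\sum_(i < L) i.+1 * g i)%N.
Proof.
rewrite (perm_sumn (permEl (perm_sort _ _))) sumn_flatten sumnE big_map big_image /=.
by apply: eq_bigr => i _; rewrite sumn_nseq.
Qed.

Lemma of_mults_partition g n :
  is_partition n (of_mults g) = (sumn (of_mults g) == n).
Proof.
rewrite /is_partition sort_sorted => [|x y]; last exact: leq_total.
by rewrite (_ : 0%N \notin _) //; apply/negP=> /mem_of_mults[].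
Qed.

(** The copies of a part x sum to at most n, so n bounds every part and every multiplicity: [L] and
    [K] leave enough room, and [inord] never falls back to its default. *)
Lemma partition_of_mults n s : (n <= L)%N -> (n <= K)%N -> is_partition n s ->
  of_mults [ffun i : 'I_L => inord (count_mem i.+1 s) : 'I_K.+1] = s.
Proof.
move=> leL leK /and3P[s_sorted s_pos /eqP sum_s].
have le_s x : (x * count_mem x s <= n)%N.
  rewrite -sum_s; elim: (s) => [|y t IHt] /=; first by rewrite muln0.
  by rewrite mulnDr leq_add //; case: eqP => [->|]; rewrite ?muln1 ?muln0.
have count_s (i : 'I_L) : (count_mem i.+1 s <= K)%N.
  by apply: leq_trans (leq_trans (le_s i.+1) leK); rewrite mulSn leq_addr.
apply: (@sorted_eq _ geq) => //.
- by move=> x y z /= le_xy le_zx; apply: leq_trans le_zx le_xy.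
- by move=> x y; rewrite andbC; apply: anti_leq.
- by apply: sort_sorted => x y; apply: leq_total.
(* Both lists are sorted, so it remains to compare multiplicities on the entries of either one. *)
apply/allP=> x; rewrite mem_cat => /orP x_in.
have [i ->] : exists i : 'I_L, x = i.+1.
  case: x_in => [/mem_of_mults // | xs].
  have x_le : (x <= n)%N.
    by apply: leq_trans (le_s x); rewrite leq_pmulr // -has_count has_pred1.
  case: x xs x_le => [|x] xs x_le; first by rewrite xs in s_pos.
  by exists (Ordinal (leq_trans x_le leL)).
by rewrite /= count_of_mults ffunE inordK ?ltnS.
Qed.

Lemma perm_partitions n : (n <= L)%N -> (n <= K)%N ->
  perm_eq (partitions n)
    [seq of_mults g
    | g : {ffun 'I_L -> 'I_K.+1} in [pred g | sumn (of_mults g) == n]].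
Proof.
move=> leL leK; apply: uniq_perm; first exact: partitions_uniq.
  by rewrite map_inj_uniq ?enum_uniq //; apply: of_mults_inj.
move=> s; rewrite mem_partitions; apply/idP/fintype.imageP=> [s_part|[g]].
  exists [ffun i : 'I_L => inord (count_mem i.+1 s)]; last first.
    by rewrite (partition_of_mults n s leL leK).
  by rewrite inE (partition_of_mults n s leL leK) //; case/and3P: s_part.
by rewrite inE => + ->; rewrite of_mults_partition.
Qed.

End Multiplicities.

(** Expanding the product chooses a multiplicity [g i] in each factor; the resulting monomial has
    degree [sumn (of_mults g)], so degree n collects exactly the partitions of n. *)
Lemma coef_partition_gf (R : comNzRingType) (f : nat -> nat -> R) (L K n : nat) :
  (n <= L)%N -> (n <= K)%N ->
  (\prod_(i < L) \sum_(m < K.+1) f i.+1 m *: 'X^(i.+1 * m))`_n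
  = \sum_(s <- partitions n) \prod_(i < L) f i.+1 (count_mem i.+1 s).
Proof.
move=> leL leK; rewrite (perm_big _ (perm_partitions L K n leL leK)) /= big_image /=.
rewrite bigA_distr_bigA coef_sum [RHS]big_mkcond; apply: eq_bigr => g _.
rewrite scaler_prod -expr_sum coefZ coefXn -sumn_of_mults inE eq_sym.
case: eqP => _; last by rewrite mulr0.
by rewrite mulr1; apply: eq_bigr => i _; rewrite count_of_mults.
Qed.

(** * Partition statistics as products and sums over part sizes *)

Lemma partition_parts n s x :
  is_partition n s -> x \in s -> exists2 i, (i < n)%N & x = i.+1.
Proof.
case/and3P=> _ s_pos /eqP <-; case: x => [|x] xs; first by rewrite xs in s_pos.
exists x => //; elim: s xs {s_pos} => //= y s IHs.
rewrite inE => /predU1P[-> | /IHs lt_x]; first exact: leq_addr.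
exact: leq_trans lt_x (leq_addl _ _).
Qed.

Lemma prod_natr_bool (R : comNzRingType) (I : finType) (b : pred I) :
  \prod_i (b i)%:R = [forall i, b i]%:R :> R.
Proof.
case: forallP => [b_all | /forallP]; first by rewrite big1 // => i _; rewrite b_all.
by rewrite negb_forall => /existsP[i /negPf b_i]; rewrite (bigD1 i) //= b_i mul0r.
Qed.

Lemma uniq_count_le1 (T : eqType) (s : seq T) :
  reflect (forall x, x \in s -> (count_mem x s <= 1)%N) (uniq s).
Proof.
apply: (iffP idP) => [s_uniq x _ | s_le1]; first by rewrite count_uniq_mem // leq_b1.
apply: count_mem_uniq => x; case: (boolP (x \in s)) => [xs | /count_memPn //].
by apply/eqP; rewrite eqn_leq s_le1 //= -has_count has_pred1.
Qed.

Section Weights.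
Variables (L n : nat) (s : seq nat).
Hypotheses (leL : (n <= L)%N) (s_part : is_partition n s).

Lemma uniq_odd_parts_mults (R : comNzRingType) :
  \prod_(i < L) (odd i.+1 ==> (count_mem i.+1 s <= 1)%N)%:R
  = (uniq (odd_parts s))%:R :> R.
Proof.
rewrite prod_natr_bool; congr (nat_of_bool _)%:R; apply/forallP/uniq_count_le1 => s_le1.
  move=> x; rewrite mem_filter => /andP[odd_x xs].
  have [i lt_in def_x] := partition_parts n s x s_part xs.
  have := s_le1 (Ordinal (leq_trans lt_in leL)).
  rewrite [nat_of_ord _]/= -def_x odd_x /=.
  apply: leq_trans; rewrite count_filter.
  by apply: sub_count => y /andP[].
move=> i; apply/implyP=> odd_i; have := s_le1 i.+1.
rewrite mem_filter odd_i count_filter /=.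
(* As [i.+1] is odd, filtering on oddness does not change its multiplicity. *)
rewrite (@eq_count _ _ (pred1 i.+1)) => [s_le1i | y /=]; last first.
  by case: eqP => // ->.
by case: (boolP (i.+1 \in s)) => [/s_le1i // | /count_memPn ->].
Qed.

Lemma uniq_mults (R : comNzRingType) :
  \prod_(i < L) (count_mem i.+1 s <= 1)%N%:R = (uniq s)%:R :> R.
Proof.
rewrite prod_natr_bool; congr (nat_of_bool _)%:R; apply/forallP/uniq_count_le1 => s_le1.
  move=> x xs; have [i lt_in ->] := partition_parts n s x s_part xs.
  exact: (s_le1 (Ordinal (leq_trans lt_in leL))).
by move=> i; case: (boolP (i.+1 \in s)) => [/s_le1 // | /count_memPn ->].
Qed.

Lemma size_odd_parts_mults :
  (\sum_(i < L) odd i.+1 * count_mem i.+1 s)%N = size (odd_parts s).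
Proof.
rewrite size_filter -sum1_count [RHS]big_mkcond /=.
under eq_bigr do rewrite -sum1_count big_mkcond big_distrr /=.
(* Each entry x of [s] is seen by the single index x - 1, where it contributes 1 if odd and 0
   otherwise. *)
rewrite exchange_big; apply: eq_big_seq => x xs.
have [i lt_in ->] := partition_parts n s x s_part xs.
rewrite (bigD1 (Ordinal (leq_trans lt_in leL))) //= eqxx big1 ?addn0 => [|j].
  by case: (~~ odd i).
by rewrite -val_eqE /= eqSS eq_sym => /negPf ->; rewrite muln0.
Qed.

End Weights.

(** * The three generating functions *)

Lemma pod_coef (R : comNzRingType) L K n : (n <= L)%N -> (n <= K)%N ->
  (pod n)%:R =
  (\prod_(i < L) \sum_(m < K.+1) (odd i.+1 ==> (m <= 1)%N)%:R *: 'X^(i.+1 * m))`_n :> R.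
Proof.
move=> leL leK; rewrite nb_partitionsE.
rewrite (coef_partition_gf R (fun k m => (odd k ==> (m <= 1)%N)%:R)) //.
apply: eq_big_seq => s; rewrite mem_partitions => s_part.
by rewrite (uniq_odd_parts_mults L n).
Qed.

Lemma p_coef (R : comNzRingType) L K n : (n <= L)%N -> (n <= K)%N ->
  (nb_partitions xpredT n)%:R =
  (\prod_(i < L) \sum_(m < K.+1) 'X^(i.+1 * m))`_n :> R.
Proof.
move=> leL leK; rewrite nb_partitionsE.
have := coef_partition_gf R (fun _ _ => 1) L K n leL leK.
under eq_bigr do under eq_bigr do rewrite scale1r.
by move->; apply: eq_bigr => s _; rewrite big1.
Qed.

(** The difference of the two counts is one sum over partitions into distinct parts, signed by (-1)
    to the number of odd parts; this sign is multiplicative over part sizes. *)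
Lemma q_eo_coef L K n : (n <= L)%N -> (n <= K)%N ->
  q_eo n%:Z =
  (\prod_(i < L) \sum_(m < K.+1)
     ((m <= 1)%N%:R * (-1) ^+ (odd i.+1 * m)) *: 'X^(i.+1 * m))`_n.
Proof.
move=> leL leK.
rewrite (coef_partition_gf _ (fun k m => (m <= 1)%N%:R * (-1) ^+ (odd k * m))) //.
rewrite /= -!natz !nb_partitionsE -sumrB.
apply: eq_big_seq => s; rewrite mem_partitions => s_part.
rewrite big_split /= (uniq_mults L n) // prodrXr (size_odd_parts_mults L n) //.
by case: (uniq s); rewrite ?mul0r // mul1r -signr_odd /=; case: (odd _).
Qed.

(** * Congruence modulo X^(n+1) *)

Definition eqmodXn {R : nzRingType} (n : nat) (A B : {poly R}) : Prop :=
  forall i, (i <= n)%N -> A`_i = B`_i.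

Section Congruence.
Variables (R : comNzRingType) (n : nat).
Implicit Types A B : {poly R}.

Lemma eqmodXnM A1 A2 B1 B2 :
  eqmodXn n A1 B1 -> eqmodXn n A2 B2 -> eqmodXn n (A1 * A2) (B1 * B2).
Proof.
move=> eq1 eq2 i le_in; rewrite !coefM; apply: eq_bigr => j _.
rewrite eq1 ?eq2 //; last by apply: leq_trans le_in; rewrite -ltnS.
exact: leq_trans (leq_subr _ _) le_in.
Qed.

Lemma eqmodXn_prod1 (I : finType) (A : I -> {poly R}) :
  (forall i, eqmodXn n (A i) 1) -> eqmodXn n (\prod_i A i) 1.
Proof.
move=> A1; apply: (big_ind (fun B => eqmodXn n B 1)) => // B C B1 C1.
by rewrite -[X in eqmodXn n _ X]mulr1; apply: eqmodXnM.
Qed.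

Lemma eqmodXn_1B k : (n < k)%N -> eqmodXn n (1 - 'X^k : {poly R}) 1.
Proof.
move=> lt_nk i le_in; rewrite coefB coefXn ltn_eqF ?subr0 //.
exact: leq_ltn_trans lt_nk.
Qed.

Lemma eqmodXn_geom K k : (n <= K)%N -> (0 < k)%N ->
  eqmodXn n ((1 - 'X^k) * \sum_(m < K.+1) 'X^(k * m) : {poly R}) 1.
Proof.
move=> le_nK k_gt0; under eq_bigr do rewrite exprM.
have -> : (1 - 'X^k) * (\sum_(m < K.+1) ('X^k) ^+ m) = 1 - 'X^(k * K.+1) :> {poly R}.
  by rewrite exprM -[RHS]opprB subrX1 -mulNr opprB.
by apply: eqmodXn_1B; apply: leq_trans (leq_pmull _ k_gt0).
Qed.

End Congruence.

(** * Euler's odd/distinct identity *)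

Lemma prod_ord_double (R : pzSemiRingType) (n : nat) (F : nat -> R) :
  \prod_(i < n.*2) F i = \prod_(i < n) (F i.*2 * F i.*2.+1).
Proof. by elim: n => [|n IHn]; rewrite ?big_ord0 // doubleS !big_ord_recr /= IHn mulrA. Qed.

(** Multiplying the product [E] by [D], a truncation of (q^2;q^2), gives [D] back modulo q^(n+1);
    [D] can then be cancelled because the geometric sums [G] invert it. *)
Lemma euler_odd_distinct (R : comNzRingType) (n : nat) :
  eqmodXn n (\prod_(i < n) ((1 - 'X^((i.*2.+1).*2)) * (1 + 'X^(i.+1.*2))) : {poly R}) 1.
Proof.
pose D : {poly R} := \prod_(i < n) (1 - 'X^(i.+1.*2)).
pose G : {poly R} := \prod_(i < n) \sum_(m < n.+1) 'X^(i.+1.*2 * m).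
set E := (X in eqmodXn n X).
have DG : eqmodXn n (D * G) 1.
  by rewrite -big_split; apply: eqmodXn_prod1 => i; apply: eqmodXn_geom.
have ED : eqmodXn n (E * D) D.
  (* With k = i+1, (1 + q^(2k))(1 - q^(2k)) = 1 - q^(4k). These and the factors 1 - q^(4i+2) make up
     [D] prolonged to 2n factors, whose second half has exponents above n. *)
  have -> : E * D = D * \prod_(i < n) (1 - 'X^((n + i).+1.*2)).
    rewrite -big_split /=.
    transitivity (\prod_(i < n.*2) (1 - 'X^(i.+1.*2) : {poly R})).
      rewrite (prod_ord_double _ n (fun i => 1 - 'X^(i.+1.*2))).
      apply: eq_bigr => i _; rewrite -mulrA; congr (_ * _).
      by rewrite mulrC -subr_sqr expr1n -exprM muln2.
    by rewrite -addnn big_split_ord.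
  rewrite -[X in eqmodXn n _ X]mulr1; apply: eqmodXnM => //.
  apply: eqmodXn_prod1 => i; apply: eqmodXn_1B.
  by rewrite -addnn addSn ltnS -addnA leq_addr.
have EDG : eqmodXn n (E * (D * G)) (E * 1) by apply: eqmodXnM.
have EDG' : eqmodXn n (E * D * G) (D * G) by apply: eqmodXnM.
by move=> i le_in; rewrite -[E]mulr1 -EDG // mulrA EDG' // DG.
Qed.

(** * The convolution identity *)

Lemma p_half (n : nat) :
  p (n%:R / 2%:R) = if odd n then 0%N else nb_partitions xpredT n./2.
Proof.
have half_double m : m.*2%:R / 2%:R = m%:R :> rat.
  by rewrite -muln2 natrM mulfK.
have n_half := odd_double_half n; rewrite /p; case: ifP => [/natrP[m def_m]|].
  have -> : n = m.*2.
    by apply/eqP; rewrite -(eqr_nat rat) -[_%:R](@divfK _ 2%:R) // def_m -muln2 natrM.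
  by rewrite half_double natrK odd_double doubleK.
by case: odd n_half => // <-; rewrite half_double natr_nat.
Qed.

Lemma p_half_convolution (n : nat) :
  (p (n%:R / 2%:R))%:Z = \sum_(j < n.+1) (pod j)%:Z * q_eo (n%:Z - j%:Z).
Proof.
(* The range [n.+2] contains the multiplicities 0 and 1 even when n = 0, as [sum2] requires. *)
pose G k : {poly int} := \sum_(m < n.+2) 'X^(k * m).
(* The 2n part sizes are paired as 2i+1, 2i+2, so that each factor below treats one odd and one even
   part. *)
pose Pod : {poly int} :=
  \prod_(i < n) ((1 + 'X^(i.*2.+1)) * G i.+1.*2).
pose Q : {poly int} :=
  \prod_(i < n) ((1 - 'X^(i.*2.+1)) * (1 + 'X^(i.+1.*2))).
have sum2 (c : nat -> int) k : (forall m, (1 < m)%N -> c m = 0) ->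
    \sum_(m < n.+2) c m *: 'X^(k * m) = (c 0%N)%:P + c 1%N *: 'X^k.
  move=> c0; rewrite !big_ord_recl big1 => [|m _]; last by rewrite c0 ?scale0r.
  by rewrite muln0 muln1 expr0 alg_polyC addr0.
have pod_Pod j : (j <= n)%N -> (pod j)%:Z = Pod`_j.
  move=> le_jn; rewrite -natz (pod_coef _ n.*2 n.+1) ?leqW //; last first.
    by rewrite -addnn (leq_trans le_jn) ?leq_addr.
  rewrite (prod_ord_double _ n
    (fun i => \sum_(m < n.+2) (odd i.+1 ==> (m <= 1)%N)%:R *: 'X^(i.+1 * m))).
  congr (polyseq _)`_j; apply: eq_bigr => i _; congr (_ * _).
    rewrite (sum2 (fun m => (odd i.*2.+1 ==> (m <= 1)%N)%:R)) => [|m lt1m].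
      by rewrite /= odd_double scale1r.
    by rewrite /= odd_double leqNgt lt1m.
  by apply: eq_bigr => m _; rewrite /= odd_double scale1r.
have q_Q j : (j <= n)%N -> q_eo j%:Z = Q`_j.
  move=> le_jn; rewrite (q_eo_coef n.*2 n.+1) ?leqW //; last first.
    by rewrite -addnn (leq_trans le_jn) ?leq_addr.
  rewrite (prod_ord_double _ n (fun i => \sum_(m < n.+2)
    ((m <= 1)%N%:R * (-1) ^+ (odd i.+1 * m)) *: 'X^(i.+1 * m))).
  congr (polyseq _)`_j; apply: eq_bigr => i _; congr (_ * _).
    rewrite (sum2 (fun m => (m <= 1)%N%:R * (-1) ^+ (odd i.*2.+1 * m))) => [|m lt1m].
      by rewrite /= odd_double muln0 muln1 !mul1r expr0 expr1 scaleN1r.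
    by rewrite leqNgt lt1m mul0r.
  rewrite (sum2 (fun m => (m <= 1)%N%:R * (-1) ^+ (odd i.*2.+2 * m))) => [|m lt1m].
    by rewrite /= odd_double !mul1r !expr0 scale1r.
  by rewrite leqNgt lt1m mul0r.
transitivity ((Pod * Q)`_n); last first.
  rewrite coefM; apply: eq_bigr => j _.
  have le_jn : (j <= n)%N by rewrite -ltnS.
  by rewrite pod_Pod // subzn // q_Q // leq_subr.
(* The odd-part factors combine by (1 - q^(2i+1))(1 + q^(2i+1)) = 1 - q^(4i+2), which yields Euler's
   product. *)
have -> : Pod * Q = \prod_(i < n)
    ((1 - 'X^((i.*2.+1).*2)) * (1 + 'X^(i.+1.*2))) * \prod_(i < n) G i.+1.*2.
  rewrite -!big_split; apply: eq_bigr => i _ /=.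
  rewrite -(muln2 i.*2.+1) exprM -[X in X - _ ^+ 2](expr1n _ 2) subr_sqr.
  rewrite mulrACA (mulrC (1 + _)) -!mulrA; congr (_ * (_ * _)).
  exact: mulrC.
rewrite (eqmodXnM _ _ _ _ _ _ (euler_odd_distinct _ n) (fun _ _ => erefl)) // mul1r.
(* What is left is the generating function of all partitions at q^2: odd coefficients vanish and the
   one of index n is p(n/2) otherwise. *)
have -> : \prod_(i < n) G i.+1.*2
    = (\prod_(i < n) \sum_(m < n.+2) 'X^(i.+1 * m)) \Po 'X^2.
  rewrite rmorph_prod; apply: eq_bigr => i _ /=.
  rewrite rmorph_sum; apply: eq_bigr => m _ /=.
  by rewrite comp_Xn_poly -exprM mulnA mul2n.
rewrite coef_comp_poly_Xn // dvdn2 p_half; case: (odd n) => //=.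
have le_half : (n %/ 2 <= n)%N by exact: leq_div.
by rewrite -natz divn2 (p_coef _ n n.+1) -?divn2 // leqW.
Qed.

Theorem theorem4p9 (n : nat) :
  (p (n%:R / 2%:R))%:Z
  = \sum_(j \in [set: nat]%classic) (pod j)%:Z * q_eo (n%:Z - j%:Z).
Proof.
rewrite p_half_convolution.
rewrite (fsbig_ord _ n.+1 (fun j => (pod j)%:Z * q_eo (n%:Z - j%:Z))).
(* For j > n the integer n - j is a [Negz], on which [q_eo] is 0. *)
apply: fsbig_widen => // j [_ /= /negP]; rewrite -leqNgt => lt_nj.
rewrite -opprB subzn ?(ltnW lt_nj) //.
by move: lt_nj; rewrite -subn_gt0; case: (j - n)%N => // k _; rewrite -NegzE mulr0.
Qed.
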